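(* Let $n$ be a positive integer and consider $\mathbb{R}^n$ as a poset with $a\le b$ if and only if $a_i\le b_i$ for all $i=1,\dots,n$. Let $\Omega$ be the strict flow on $(\mathbb{R}^n,\le)$ given by $\Omega_\varepsilon(a)=a+\varepsilon=(a_1+\varepsilon,\dots,a_n+\varepsilon)$. Then the interleaving distance $d_{(\mathbb{R}^n,\le)}$ induced by $\Omega$ coincides with the $L^\infty$-distance: for all $a,b\in\mathbb{R}^n$, $$d_{(\mathbb{R}^n,\le)}(a,b)=\|a-b\|_\infty .$$
   Context: $\|a-b\|_\infty=\max\{|a_i-b_i| : i=1,\dots,n\}$. A flow $\mathcal{T}=(\mathcal{T},u,\mu)$ on a category $\mathcal{C}$ consists of: a functor $\mathcal{T}:([0,\infty),\le)\to\mathrm{End}(\mathcal{C})$, $\varepsilon\mapsto\mathcal{T}_\varepsilon$ (with $\mathcal{T}_{(\varepsilon\le\zeta)}:\mathcal{T}_\varepsilon\Rightarrow\mathcal{T}_\zeta$ the natural transformation assigned to $\varepsilon\le\zeta$); a natural transformation $u:I_{\mathcal{C}}\Rightarrow\mathcal{T}_0$; and natural transformations $\mu_{\varepsilon,\zeta}:\mathcal{T}_\varepsilon\mathcal{T}_\zeta\Rightarrow\mathcal{T}_{\varepsilon+\zeta}$ for all $\varepsilon,\zeta\ge0$; such that for all $\varepsilon,\zeta,\delta,\kappa\ge 0$: (i) $\mu_{0,\varepsilon}\circ(u\,\mathcal{T}_\varepsilon)=\mathrm{id}_{\mathcal{T}_\varepsilon}$ and $\mu_{\varepsilon,0}\circ(\mathcal{T}_\varepsilon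 u)=\mathrm{id}_{\mathcal{T}_\varepsilon}$; (ii) $\mu_{\varepsilon,\zeta+\delta}\circ(\mathcal{T}_\varepsilon\mu_{\zeta,\delta})=\mu_{\varepsilon+\zeta,\delta}\circ(\mu_{\varepsilon,\zeta}\mathcal{T}_\delta)$; (iii) $\mu_{\delta,\kappa}\circ(\mathcal{T}_{(\varepsilon\le\delta)}\mathcal{T}_{(\zeta\le\kappa)})=\mathcal{T}_{(\varepsilon+\zeta\le\delta+\kappa)}\circ\mu_{\varepsilon,\zeta}$ whenever $\varepsilon\le\delta$ and $\zeta\le\kappa$. The flow is strict if $u$ and all $\mu_{\varepsilon,\zeta}$ are identities. A weak $\varepsilon$-interleaving of objects $a,b$ of $\mathcal{C}$ is a pair of morphisms $\varphi:a\to\mathcal{T}_\varepsilon b$, $\psi:b\to\mathcal{T}_\varepsilon a$ such that $\mu_{\varepsilon,\varepsilon,a}\circ\mathcal{T}_\varepsilon\psi\circ\varphi=\mathcal{T}_{(0\le2\varepsilon),a}\circ u_a$ and $\mu_{\varepsilon,\varepsilon,b}\circ\mathcal{T}_\varepsilon\varphi\circ\psi=\mathcal{T}_{(0\le2\varepsilon),b}\circ u_b$. The interleaving distance between $a$ and $b$ induced by the flow is $\inf\{\varepsilon\ge0\mid \text{there is a weak }\varepsilon\text{-interleaving of }a,b\}$, with value $\infty$ if there is none for any $\varepsilon$. The poset $(\mathbb{R}^n,\le)$ is viewed as a category; $\Omega_\varepsilon$ sends $a\le b$ to $a+\varepsilon\le b+\varepsilon$, and for $\varepsilon\le\zeta$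 the transformation $\Omega_{(\varepsilon\le\zeta)}$ has components $a+\varepsilon\le a+\zeta$. *)

(* Defs.v *)
From HB Require Import structures.
From mathcomp Require Import all_boot all_order all_algebra.
From mathcomp Require Import all_classical all_reals all_analysis.

Set Implicit Arguments.
Unset Strict Implicit.
Unset Printing Implicit Defensive.

Import Order.TTheory GRing.Theory Num.Theory.
Import numFieldNormedType.Exports.

Local Open Scope classical_set_scope.
Local Open Scope ring_scope.

Local Obligation Tactic := idtac.

Record category := Category {
  obj :> Type;
  hom : obj -> obj -> Type;
  idm : forall a, hom a a;
  compm : forall a b c, hom b c -> hom a b -> hom a c;
  compm1 : forall a b (f : hom a b), compm f (idm a) = f;
  comp1m : forall a b (f : hom a b), compm (idm b) f = f;
  compmA : forall a b c d (h : hom c d) (g : hom b c) (f : hom a b),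
    compm h (compm g f) = compm (compm h g) f }.

Arguments idm {_} a.
Arguments compm {_ _ _ _} g f : rename.

Notation "g \oc f" := (compm g f) (at level 50, left associativity).

(* The identity, seen as a morphism between two propositionally equal objects. *)
Definition eq_hom (C : category) (a b : C) (e : a = b) : hom a b :=
  match e in _ = c return hom a c with erefl => idm a end.

Definition is_identity (C : category) (a b : C) (f : hom a b) : Prop :=
  exists e : a = b, f = eq_hom e.

Record functor (C D : category) := Functor {
  fobj :> C -> D;
  fmap : forall a b : C, hom a b -> hom (fobj a) (fobj b);
  fmap1 : forall a, fmap (idm a) = idm (fobj a);
  fmap_comp : forall (a b c : C) (g : hom b c) (f : hom a b),
    fmap (g \oc f) = fmap g \oc fmap f }.

Arguments fmap {_ _} f {_ _} g : rename.

Program Definition id_functor (C : category) : functor C C :=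
  @Functor C C (fun a => a) (fun _ _ f => f) _ _.
Next Obligation. by []. Qed.
Next Obligation. by []. Qed.

Program Definition comp_functor (C D E : category)
    (G : functor D E) (F : functor C D) : functor C E :=
  @Functor C E (fun a => G (F a)) (fun _ _ f => fmap G (fmap F f)) _ _.
Next Obligation. by move=> C D E G F a /=; rewrite !fmap1. Qed.
Next Obligation. by move=> C D E G F a b c g f /=; rewrite !fmap_comp. Qed.

Record nat_trans (C D : category) (F G : functor C D) := NatTrans {
  component :> forall a, hom (F a) (G a);
  naturality : forall (a b : C) (f : hom a b),
    component b \oc fmap F f = fmap G f \oc component a }.

Lemma nat_trans_eq (C D : category) (F G : functor C D) (s t : nat_trans F G) :
  (forall a, s a = t a) -> s = t.
Proof.
case: s t => [s sN] [t tN] /= st.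
have {}st : s = t by apply: functional_extensionality_dep.
by subst t; congr NatTrans; exact: Prop_irrelevance.
Qed.

Program Definition nat_id (C D : category) (F : functor C D) : nat_trans F F :=
  @NatTrans C D F F (fun a => idm (F a)) _.
Next Obligation. by move=> C D F a b f /=; rewrite compm1 comp1m. Qed.

Program Definition nat_comp (C D : category) (F G H : functor C D)
    (t : nat_trans G H) (s : nat_trans F G) : nat_trans F H :=
  @NatTrans C D F H (fun a => t a \oc s a) _.
Next Obligation.
move=> C D F G H t s a b f.
by rewrite /= -compmA naturality compmA naturality compmA.
Qed.

Program Definition functor_category (C D : category) : category :=
  @Category (functor C D) (@nat_trans C D) (@nat_id C D) (@nat_comp C D) _ _ _.
Next Obligation. by move=> C D F G s; apply: nat_trans_eq => a; exact: compm1. Qed.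
Next Obligation. by move=> C D F G s; apply: nat_trans_eq => a; exact: comp1m. Qed.
Next Obligation.
by move=> C D F G H K h g f; apply: nat_trans_eq => a; exact: compmA.
Qed.

Definition End_category (C : category) : category := functor_category C C.

(* A hom-set is the type of proofs of [a <= b], so it has at most one element. *)
Program Definition poset_category d (P : porderType d) : category :=
  @Category P (fun a b => (a <= b)%O) (fun a => lexx a)
    (fun a b c bc ab => le_trans ab bc) _ _ _.
Next Obligation. by move=> d P a b f; exact: bool_irrelevance. Qed.
Next Obligation. by move=> d P a b f; exact: bool_irrelevance. Qed.
Next Obligation. by move=> d P a b c e h g f; exact: bool_irrelevance. Qed.

Section Flow.
Variable R : realType.
Implicit Types e z d k : {nonneg R}.

Definition addnng e z : {nonneg R} := (e%:num + z%:num)%:nng.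

Lemma addnngA e z d : addnng e (addnng z d) = addnng (addnng e z) d.
Proof. by apply/val_inj; rewrite /= addrA. Qed.

Lemma add0nng e : addnng 0%:nng e = e.
Proof. by apply/val_inj; rewrite /= add0r. Qed.

Lemma addnng0 e : addnng e 0%:nng = e.
Proof. by apply/val_inj; rewrite /= addr0. Qed.

Lemma le_addnng e d z k : e <= d -> z <= k -> addnng e z <= addnng d k.
Proof. by rewrite -!num_le /=; exact: lerD. Qed.

Lemma nng_ge0 e : 0%:nng <= e.
Proof. by rewrite -num_le /=. Qed.

Variable C : category.

Definition flow_functor := functor (poset_category {nonneg R}) (End_category C).

Definition flow_at (T : flow_functor) e : functor C C := T e.

Definition flow_le (T : flow_functor) e z (ez : e <= z) :
  nat_trans (flow_at T e) (flow_at T z) := fmap T ez.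

(* The codomains [T_(0 + e) a] and [T_e a], or [T_(e + (z + d)) a] and
   [T_((e + z) + d) a], are only propositionally equal; [flow_cast] is the
   identity morphism between them. *)
Definition flow_cast (T : flow_functor) e z (E : e = z) (a : C) :
  hom (flow_at T e a) (flow_at T z a) :=
  eq_hom (congr1 (fun x => flow_at T x a) E).

Record flow := Flow {
  flow_fun :> flow_functor;
  flow_unit : nat_trans (id_functor C) (flow_at flow_fun 0%:nng);
  flow_mul : forall e z,
    nat_trans (comp_functor (flow_at flow_fun e) (flow_at flow_fun z))
              (flow_at flow_fun (addnng e z));
  flow_unitl : forall e a,
    flow_cast flow_fun (add0nng e) a
      \oc (flow_mul 0%:nng e a \oc flow_unit (flow_at flow_fun e a))
    = idm (flow_at flow_fun e a);
  flow_unitr : forall e a,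
    flow_cast flow_fun (addnng0 e) a
      \oc (flow_mul e 0%:nng a \oc fmap (flow_at flow_fun e) (flow_unit a))
    = idm (flow_at flow_fun e a);
  flow_assoc : forall e z d a,
    flow_cast flow_fun (addnngA e z d) a
      \oc (flow_mul e (addnng z d) a
           \oc fmap (flow_at flow_fun e) (flow_mul z d a))
    = flow_mul (addnng e z) d a \oc flow_mul e z (flow_at flow_fun d a);
  flow_mul_le : forall e d z k (ed : e <= d) (zk : z <= k) a,
    flow_mul d k a
      \oc (flow_le flow_fun ed (flow_at flow_fun k a)
           \oc fmap (flow_at flow_fun e) (flow_le flow_fun zk a))
    = flow_le flow_fun (le_addnng ed zk) a \oc flow_mul e z a }.

Definition strict_flow (T : flow) : Prop :=
  @is_identity (End_category C) (id_functor C) (flow_at T 0%:nng) (flow_unit T) /\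
  forall e z,
    @is_identity (End_category C) (comp_functor (flow_at T e) (flow_at T z))
      (flow_at T (addnng e z)) (flow_mul T e z).

Definition is_weak_interleaving (T : flow) e (a b : C)
    (phi : hom a (flow_at T e b)) (psi : hom b (flow_at T e a)) : Prop :=
  flow_mul T e e a \oc fmap (flow_at T e) psi \oc phi
    = flow_le T (nng_ge0 (addnng e e)) a \oc flow_unit T a /\
  flow_mul T e e b \oc fmap (flow_at T e) phi \oc psi
    = flow_le T (nng_ge0 (addnng e e)) b \oc flow_unit T b.

Definition interleaving_dist (T : flow) (a b : C) : \bar R :=
  ereal_inf [set e%:num%:E | e in [set e : {nonneg R} |
    exists (phi : hom a (flow_at T e b)) (psi : hom b (flow_at T e a)),
      is_weak_interleaving phi psi]].

End Flow.

Section Rn.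
Variables (R : realType) (n : nat).
Implicit Types a b : 'rV[R]_n.

Definition le_rV a b := [forall i, a 0 i <= b 0 i].

Lemma le_rV_refl : reflexive le_rV.
Proof. by move=> a; apply/forallP. Qed.

Lemma le_rV_anti : antisymmetric le_rV.
Proof.
move=> a b /andP[/forallP ab /forallP ba]; apply/rowP => i.
by apply/le_anti; rewrite ab ba.
Qed.

Lemma le_rV_trans : transitive le_rV.
Proof.
move=> b a c /forallP ab /forallP bc; apply/forallP => i.
exact: le_trans (ab i) (bc i).
Qed.

HB.instance Definition _ := Order.Le_isPOrder.Build ring_display 'rV[R]_n
  le_rV_refl le_rV_anti le_rV_trans.

Lemma le_rVP a b : reflect (forall i, a 0 i <= b 0 i) (a <= b).
Proof. exact: forallP. Qed.

Lemma norm_rVE a : `|a| = \big[Num.max/0]_(i < n) `|a 0 i|.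
Proof.
rewrite [LHS]mx_normrE; apply/eqP; rewrite eq_le; apply/andP; split.
  apply/bigmax_leP; split=> [|[i j] _ /=]; first exact: bigmax_ge_id.
  by rewrite ord1; exact: (le_bigmax _ (fun i => `|a 0 i|) j).
apply/bigmax_leP; split=> [|i _]; first exact: bigmax_ge_id.
exact: (le_bigmax _ (fun i => `|a i.1 i.2|) (0, i)).
Qed.

Definition Rn_category : category := poset_category 'rV[R]_n.

Definition translate (e : {nonneg R}) a : 'rV[R]_n := \row_i (a 0 i + e%:num).

Lemma translate_le e z a b : e <= z -> a <= b -> translate e a <= translate z b.
Proof.
rewrite -num_le => ez /le_rVP ab; apply/le_rVP => i.
by rewrite !mxE lerD.
Qed.

Lemma translate0 a : translate 0%:nng a = a.
Proof. by apply/rowP => i; rewrite mxE addr0. Qed.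

Lemma translate_add e z a : translate e (translate z a) = translate (addnng e z) a.
Proof. by apply/rowP => i; rewrite !mxE /= -addrA (addrC z%:num). Qed.

Program Definition Omega_at (e : {nonneg R}) :
    functor Rn_category Rn_category :=
  @Functor Rn_category Rn_category (translate e)
    (fun a b ab => translate_le (lexx e) ab) _ _.
Next Obligation. by move=> *; exact: bool_irrelevance. Qed.
Next Obligation. by move=> *; exact: bool_irrelevance. Qed.

Program Definition Omega_le (e z : {nonneg R}) (ez : e <= z) :
    nat_trans (Omega_at e) (Omega_at z) :=
  @NatTrans Rn_category Rn_category (Omega_at e) (Omega_at z)
    (fun a => translate_le ez (lexx a)) _.
Next Obligation. by move=> *; exact: bool_irrelevance. Qed.

Program Definition Omega_functor : flow_functor R Rn_category :=
  @Functor (poset_category {nonneg R}) (End_category Rn_category) Omega_at Omega_le _ _.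
Next Obligation.
by move=> e; apply: nat_trans_eq => a; exact: bool_irrelevance.
Qed.
Next Obligation.
by move=> *; apply: nat_trans_eq => ?; exact: bool_irrelevance.
Qed.

Program Definition Omega_unit :
    nat_trans (id_functor Rn_category) (Omega_at 0%:nng) :=
  @NatTrans Rn_category Rn_category _ _
    (fun a => eq_hom (C := Rn_category) (esym (translate0 a))) _.
Next Obligation. by move=> *; exact: bool_irrelevance. Qed.

Program Definition Omega_mul (e z : {nonneg R}) :
    nat_trans (comp_functor (Omega_at e) (Omega_at z))
              (Omega_at (addnng e z)) :=
  @NatTrans Rn_category Rn_category _ _
    (fun a => eq_hom (C := Rn_category) (translate_add e z a)) _.
Next Obligation. by move=> *; exact: bool_irrelevance. Qed.

Program Definition Omega : flow R Rn_category :=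
  @Flow R Rn_category Omega_functor Omega_unit Omega_mul _ _ _ _.
Next Obligation. by move=> *; exact: bool_irrelevance. Qed.
Next Obligation. by move=> *; exact: bool_irrelevance. Qed.
Next Obligation. by move=> *; exact: bool_irrelevance. Qed.
Next Obligation. by move=> *; exact: bool_irrelevance. Qed.

Lemma Rn_functor_eq (F G : functor Rn_category Rn_category) :
  (forall a, F a = G a) -> F = G.
Proof.
case: F G => [F mF F1 Fc] [G mG G1 Gc] /= FG.
have {}FG : F = G by apply: funext.
subst G; have mFG : mF = mG.
  do 3!apply: functional_extensionality_dep => ?; exact: bool_irrelevance.
by subst mG; congr Functor; exact: Prop_irrelevance.
Qed.

Lemma Omega_strict : strict_flow Omega.
Proof.
split=> [|e z].
  exists (Rn_functor_eq (F := id_functor Rn_category) (G := Omega_at 0%:nng)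
            (fun a => esym (translate0 a))).
  by apply: nat_trans_eq => a; exact: bool_irrelevance.
exists (Rn_functor_eq (F := comp_functor (Omega_at e) (Omega_at z))
          (G := Omega_at (addnng e z)) (translate_add e z)).
by apply: nat_trans_eq => a; exact: bool_irrelevance.
Qed.

End Rn.

(* Main.v *)
Require Import Defs.
From mathcomp Require Import all_boot all_order all_algebra.
From mathcomp Require Import all_classical all_reals all_analysis.
Import Order.TTheory GRing.Theory Num.Theory.
Import numFieldNormedType.Exports.
Local Open Scope ring_scope.

(** In a poset category any two parallel morphisms are equal, so the two
    equations of a weak interleaving hold automatically: [a] and [b] are
    [e]-interleaved exactly when [a <= b + e] and [b <= a + e] in the product
    order.  Coordinatewise this pair of inequalities is [`|a i - b i| <= e] for
    all [i], that is [`|a - b| <= e] for the sup norm ([translate_le_normP],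
    [Omega_interleavedP]).
    The interleaving distance is therefore the infimum of the ray of all
    nonnegative [e >= `|a - b|], and the ray contains its endpoint because a
    norm is nonnegative. *)

(** The norm is the maximum of the [`|a i - b i|], and an absolute value
    bound splits into two one-sided bounds, one for each translate. *)
Lemma translate_le_normP (R : realType) (n : nat) (e : {nonneg R})
    (a b : 'rV[R]_n) :
  (a <= translate e b) && (b <= translate e a) = (`|a - b| <= e%:num).
Proof.
rewrite norm_rVE; apply/andP/bigmax_leP => [[/le_rVP ab /le_rVP ba]|[_ abe]].
  split=> // i _; move: (ab i) (ba i).
  by rewrite !mxE ler_distl lerBlDr => -> ->.
by split; apply/le_rVP => i; move: (abe i isT);
  rewrite !mxE ler_distl lerBlDr => /andP[].
Qed.

(** Morphisms are proofs of inequalities between translates, and proof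
    irrelevance of booleans settles the interleaving equations. *)
Lemma Omega_interleavedP (R : realType) (n : nat) (e : {nonneg R})
    (a b : 'rV[R]_n) :
  (exists (phi : @Defs.hom (Rn_category R n) a (flow_at (Omega R n) e b))
          (psi : @Defs.hom (Rn_category R n) b (flow_at (Omega R n) e a)),
      is_weak_interleaving phi psi)
  <-> `|a - b| <= e%:num.
Proof.
rewrite -translate_le_normP; split=> [[phi [psi _]]|/andP[phi psi]].
  by apply/andP; split; [exact: phi | exact: psi].
by exists phi, psi; split; exact: bool_irrelevance.
Qed.

Theorem theorem3p9 (R : realType) (n : nat) (n_gt0 : (0 < n)%N)
    (a b : 'rV[R]_n) :
  interleaving_dist (Omega R n) a b = `|a - b|%:E.
Proof.
apply/eqP; rewrite eq_le; apply/andP; split.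
  apply: ereal_inf_lbound; exists (`|a - b|%:nng) => //=.
  exact/Omega_interleavedP.
apply: le_ereal_inf_tmp => _ [e /= /Omega_interleavedP abe <-].
by rewrite lee_fin.
Qed.
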